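(* Let $r,d$ be integers with $0\le r<d$ and let $n\ge 1$ be an integer. Let $\lambda^d_r(n)$ and $\lambda^d_r(n)^\#$ denote the $n$-th terms of the polytope number sequence and of the interior number sequence of the $r$-rectified $d$-dimensional simplex, and let $\alpha^d(\cdot)$ and $\alpha^d(\cdot)^\#$ denote the polytope number sequence and interior number sequence of the $d$-dimensional simplex. Then $$\lambda^{d}_{r}(n)=\sum_{i=0}^{r}(-1)^{r-i}\binom{d+1}{r-i}\,\alpha^d\big((i+1)n-r\big)$$ and $$\lambda^{d}_{r}(n)^\#=\sum_{i=0}^{r}(-1)^{r-i}\binom{d+1}{r-i}\,\alpha^d\big((i+1)n+r-2i\big)^\#.$$
   Context: Polytope numbers. Let $P$ be a $d$-dimensional uniform (in particular vertex-transitive) convex polytope all of whose faces are also uniform, and fix a vertex $\mathbf v_P$ of $P$. Write $\mathcal F(P)$ for the set of all faces of $P$ of dimensions $0,1,\dots,d$ (so $P\in\mathcal F(P)$ and the empty face is not included). The polytope number sequence $\{P(n)\}_{n\ge 0}$ and the interior number sequence $\{P(n)^\#\}_{n\ge 0}$ are defined by recursion on $d$, each face $F$ of $P$ being regarded as a polytope in its own right. - If $d=0$: $P(0)=P(0)^\#=0$ and $P(n)=P(n)^\#=1$ for $n\ge 1$. - If $d>0$: $P(0)=P(0)^\#=0$, $P(1)=1$, $P(1)^\#=0$, and for $n\ge 2$ $$P(n)=P(n-1)+\sum_{F\in\mathcal F(P),\ \mathbf v_P\notin F}F(n)^\#,\qquad P(n)^\#=P(n)-\sum_{F\in\mathcal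 F(P)\setminus\{P\}}F(n)^\#.$$ Simplex numbers. $\alpha^d(n)$ and $\alpha^d(n)^\#$ are these two sequences for the $d$-dimensional regular simplex. Explicitly, for $d\ge 1$: $\alpha^d(n)=\binom{n+d-1}{d}$ for $n\ge 1$ and $\alpha^d(n)=0$ for $n\le 0$; $\alpha^d(n)^\#=\alpha^d(n-d-1)=\binom{n-2}{d}$ for $n\ge 2$ and $\alpha^d(n)^\#=0$ for $n\le 1$. Rectification. For $1\le r<d$, the $r$-rectification of a $d$-dimensional polytope is the polytope obtained by cutting off each vertex to the center of each $r$-face containing that vertex. For the regular $d$-simplex the result is the uniform polytope which is the convex hull of the centers (centroids) of the $r$-dimensional faces of the simplex. The $0$-rectified $d$-simplex is the $d$-simplex itself. *)

(* Defs.v *)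
From HB Require Import structures.
From mathcomp Require Import all_boot all_order all_algebra.
From mathcomp Require Import finmap mathcomp_extra boolp classical_sets functions.
From mathcomp Require Import cardinality fsbigop reals convex.

Set Implicit Arguments.
Unset Strict Implicit.
Unset Printing Implicit Defensive.

Import Order.TTheory GRing.Theory Num.Theory.
Local Open Scope classical_set_scope.
Local Open Scope ring_scope.

Section Polytopes.
Variables (R : realType) (m : nat).
Local Notation V := 'rV[R]_m.
Implicit Types (A P F : set V) (x : V).

Definition conv_hull A : set V := smallest (@convex_set R V) A.

Definition polytope P : Prop :=
  exists s : seq V, s != [::] /\ P = conv_hull [set` s].

(* The linear form 0 gives P itself; the empty face is excluded. *)
Definition faces P : set (set V) :=
  [set F | F !=set0 /\ exists c : {scalar V},
             F = [set x | P x /\ forall y, P y -> c y <= c x]].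

Definition vertices P : set V := [set x | faces P [set x]].

(* Dimension of the affine hull: the largest number of linearly independent
   differences of points of A. *)
Definition affdim A : nat :=
  (\max_(k < m.+1 | `[< exists2 M : 'M[R]_(k, m), row_free M &
      forall i, exists x y, [/\ A x, A y & row i M = x - y]%R >]) k)%N.

Definition vertex_choice (v : set V -> V) : Prop :=
  forall P, polytope P -> vertices P (v P).

(* One step of the recursion, for a polytope of positive dimension: I gives the
   interior numbers of the proper faces, and x is the chosen vertex. A polytope
   has finitely many faces, so the finitely supported sums are plain sums. *)
Fixpoint pnum_step (I : set V -> nat -> int) x P (n : nat) : int :=
  match n with
  | 0 => 0
  | 1 => 1
  | n'.+1 => pnum_step I x P n'
             + \sum_(F \in [set F | faces P F /\ ~ F x]) I F n
  end.

Definition inum_step (I : set V -> nat -> int) x P (n : nat) : int :=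
  if (n <= 1)%N then 0
  else pnum_step I x P n - \sum_(F \in faces P `\ P) I F n.

(* Interior numbers of the polytopes of dimension at most d. *)
Fixpoint inum_upto (v : set V -> V) (d : nat) : set V -> nat -> int :=
  match d with
  | 0 => fun _ n => (0 < n)%N%:Z
  | d'.+1 => fun P => if (affdim P <= d')%N then inum_upto v d' P
                      else inum_step (inum_upto v d') (v P) P
  end.

(* P(n)^# and P(n), where v F is the distinguished vertex of each face F. *)
Definition inum v P : nat -> int := inum_upto v (affdim P) P.

Definition pnum v P (n : nat) : int :=
  if affdim P == 0%N then (0 < n)%N%:Z else pnum_step (inum v) (v P) P n.

(* Extension of a sequence by 0 to negative arguments. *)
Definition seq_at (a : nat -> int) (z : int) : int :=
  if z is Posz n then a n else 0.

Definition centroid P : V :=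
  (#|` fset_set (vertices P)|%:R)^-1 *: \sum_(x \in vertices P) x.

(* The r-rectification of a regular simplex P: the hull of the centers of its
   r-faces. For r = 0 these are the vertices, and the result is P. *)
Definition rectified_simplex (r : nat) P : set V :=
  conv_hull [set centroid F | F in [set F | faces P F /\ affdim F = r]].

Definition sqdist (x y : V) : R := \sum_k (x 0 k - y 0 k) ^+ 2.

(* d + 1 points at equal positive mutual distance are affinely independent, so
   P has dimension d. *)
Definition regular_simplex (d : nat) P : Prop :=
  exists p : 'I_d.+1 -> V,
    (exists2 l, 0 < l & forall i j, i != j -> sqdist (p i) (p j) = l) /\
    P = conv_hull (range p).

Lemma affdimP A : exists2 M : 'M[R]_(affdim A, m), row_free M &
  forall i, exists x y, [/\ A x, A y & row i M = x - y].
Proof.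
suff [k /asboolP kP <-] : exists2 k : 'I_m.+1,
    `[< exists2 M : 'M[R]_(k, m), row_free M &
        forall i, exists x y, [/\ A x, A y & row i M = x - y] >] &
    nat_of_ord k = affdim A by [].
rewrite /affdim (bigop.bigmax_eq_arg ord0); last first.
  apply/asboolP; exists 0; last by case.
  by rewrite /row_free mxrank0.
case: arg_maxnP => [|k kP _]; last by exists k.
apply/asboolP; exists 0; last by case.
by rewrite /row_free mxrank0.
Qed.

Lemma affdim_ge A k (M : 'M[R]_(k, m)) : row_free M ->
  (forall i, exists x y, [/\ A x, A y & row i M = x - y]) ->
  (k <= affdim A)%N.
Proof.
move=> fM hM.
have km : (k < m.+1)%N by rewrite ltnS -(eqP fM) rank_leq_col.
rewrite /affdim -[k]/(nat_of_ord (Ordinal km)).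
by rewrite (leq_bigmax_cond (F := @nat_of_ord m.+1))//; apply/asboolP; exists M.
Qed.

Lemma affdim_face P F : faces P F -> F <> P -> (affdim F < affdim P)%N.
Proof.
move=> [[x Fx] [c FE]] FP.
have FcE z z' : F z -> F z' -> c z = c z'.
  rewrite FE => -[Pz hz] [Pz' hz']; apply/eqP.
  by rewrite eq_le hz ?hz'.
have subFP : F `<=` P by rewrite FE => z [].
have [y Py cy] : exists2 y, P y & c y < c x.
  apply: contrapT => h; apply: FP; apply/seteqP; split=> // z Pz.
  rewrite FE; split=> // t Pt; move: Fx; rewrite {1}FE => -[_ /(_ _ Pt)] tx.
  apply: le_trans tx _; rewrite leNgt; apply/negP => zx.
  by apply: h; exists z.
have [M fM hM] := affdimP F.
pose N : 'M[R]_(1 + affdim F, m) := col_mx (y - x) M.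
apply: (@affdim_ge _ _ N); last first.
  move=> i; case: (splitP i) => j ij.
    exists y, x; split; [by []|exact: subFP|].
    have -> : i = lshift _ j by apply/val_inj.
    by rewrite rowKu row_id.
  have [a [b [Fa Fb ab]]] := hM j; exists a, b; split; [exact: subFP..|].
  have -> : i = rshift _ j by apply/val_inj.
  by rewrite rowKd.
rewrite -kermx_eq0; apply/rowV0P => w /sub_kermxP.
rewrite -[w]hsubmxK mul_row_col => wN.
have cM (u : 'rV[R]_(affdim F)) : c (u *m M) = 0.
  rewrite mulmx_sum_row linear_sum big1// => i _.
  have [a [b [Fa Fb ->]]] := hM i.
  by rewrite linearZ linearB/= (FcE _ _ Fa Fb) subrr mulr0.
have wl0 : lsubmx w = 0.
  have := congr1 c wN; rewrite linearD /= cM addr0 linear0.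
  rewrite [lsubmx w]mx11_scalar mul_scalar_mx linearZ linearB/= => /eqP.
  by rewrite mulf_eq0 subr_eq0 (lt_eqF cy) orbF => /eqP ->; rewrite raddf0.
move: wN; rewrite wl0 mul0mx add0r => wM.
have -> : rsubmx w = 0.
  by apply: (row_free_inj fM); rewrite mul0mx.
by rewrite row_mx0.
Qed.

Lemma inum_uptoE v d P : (affdim P <= d)%N -> inum_upto v d P = inum v P.
Proof.
elim: d => [|d IHd] /=; first by rewrite leqn0 /inum => /eqP ->.
case: ifP => [/IHd //|]; rewrite leqNgt => /negbFE dP Pd.
have PdE : affdim P = d.+1 by apply/eqP; rewrite eqn_leq Pd.
by rewrite /inum PdE /= PdE ltnn.
Qed.

(* inum and pnum satisfy the defining recursion; the induction is on affdim,
   which drops on proper faces by affdim_face. *)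
Lemma pnum_dim0 v P n : affdim P = 0%N -> pnum v P n = (0 < n)%N%:Z.
Proof. by rewrite /pnum => ->. Qed.

Lemma inum_dim0 v P n : affdim P = 0%N -> inum v P n = (0 < n)%N%:Z.
Proof. by rewrite /inum => ->. Qed.

Lemma pnum_0 v P : pnum v P 0 = 0.
Proof. by rewrite /pnum; case: eqP. Qed.

Lemma pnum_1 v P : pnum v P 1 = 1.
Proof. by rewrite /pnum; case: eqP. Qed.

Lemma inum_small v P n : (0 < affdim P)%N -> (n <= 1)%N -> inum v P n = 0.
Proof.
rewrite /inum; case dP: (affdim P) => [//|d] _ n1 /=.
by rewrite dP ltnn /inum_step n1.
Qed.

Lemma pnum_rec v P n : (0 < affdim P)%N -> (2 <= n)%N ->
  pnum v P n = pnum v P n.-1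
               + \sum_(F \in [set F | faces P F /\ ~ F (v P)]) inum v F n.
Proof. by rewrite /pnum lt0n => /negbTE ->; case: n => [|[|n]]. Qed.

Lemma inum_rec v P n : (0 < affdim P)%N -> P (v P) -> (2 <= n)%N ->
  inum v P n = pnum v P n - \sum_(F \in faces P `\ P) inum v F n.
Proof.
move=> P0 Pv n2; rewrite {1}/inum /pnum.
case dP: (affdim P) P0 => [//|d] _ /=.
rewrite dP ltnn /inum_step leqNgt n2 /=.
have FE F k : faces P F -> F <> P -> inum_upto v d F k = inum v F k.
  by move=> PF FP; rewrite inum_uptoE// -ltnS -dP affdim_face.
congr (_ - _); last by apply: eq_fsbigr => F /set_mem[? ?]; rewrite FE.
elim: n {n2} => [|[|n] IHn] //=; congr (_ + _); first exact: IHn.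
by apply: eq_fsbigr => F /set_mem[PF Fv]; rewrite FE// => FP; apply: Fv; rewrite FP.
Qed.

End Polytopes.

(* Main.v *)
From HB Require Import structures.
Require Import Defs.
From mathcomp Require Import all_boot all_order all_algebra.
From mathcomp Require Import finmap boolp classical_sets cardinality fsbigop.
From mathcomp Require Import interval_inference reals convex.
From mathcomp Require Import zify ring lra.

Set Implicit Arguments.
Unset Strict Implicit.
Unset Printing Implicit Defensive.

Import Order.TTheory GRing.Theory Num.Theory.
Local Open Scope classical_set_scope.
Local Open Scope ring_scope.

(** The [r]-rectified [d]-simplex is, up to affine equivalence, the hypersimplex
    of all [x] in the cube [[0, 1]^(d+1)] with coordinate sum [k = r + 1]. The
    theorem holds because polytope numbers of hypersimplices count lattice
    points: for [t >= 0] the number with index [t + 1] is the number of integer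
    vectors in [{0, ..., t}^(d+1)] with sum [k * t], and for [t >= 1] the
    interior number with index [t + 1] counts those with all entries strictly
    between 0 and [t]. The simplex is the case [k = 1].

    The reason is that each vertex [w] has lattice distance at most 1 from each
    facet. A lattice point [a] of the dilate [(t+1)P] then satisfies one of two
    alternatives: either [a - w] lies in [tP], or the face of [(t+1)P] containing
    [a] in its relative interior avoids [w] (lemma [lattice_shift]). Since every
    lattice point is in the relative interior of exactly one face, this turns
    the defining recursion into a partition of the lattice points of [(t+1)P],
    and an induction on the dimension proves the count ([cell_numbers]). The
    argument needs only that the polytope is given by bounds
    [0 <= f_i(x) <= 1] on affine functions which take the values 0 and 1 at the
    vertices; for hypersimplices the latter is [hypersimplex_hull].

    What remains is to count vectors with bounded entries and given sum. Their
    generating polynomial is [((1 - X^b) / (1 - X))^(d+1)], and expanding the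
    numerator ([coef_geom]) expresses the count as an alternating sum, with
    coefficients [binomial(d+1, j)], of counts of vectors with unbounded entries.
    The latter are simplex numbers. With [b = t + 1] this gives the first formula.
    For interior points subtract 1 from all entries, which makes [b = t - 1] and
    lowers the sum by [d + 1], for the simplex as for the hypersimplex. The terms
    with [j > r] vanish, and [i = r - j].

    Two facts connect this with the geometric definitions: the faces of a
    simplex and their centroids are given by subsets of the vertices
    ([rectified_simplex_hull]), and a regular simplex has affine forms dual to
    its vertices ([equidistant_dual]). *)

(** * Convex hulls, linear forms and affine dimension *)

Section ConvexHulls.
Variables (R : realType) (m : nat).
Local Notation V := 'rV[R]_m.
Implicit Types (A B : set V) (x y : V).

Lemma convex_setP A :
  (forall x y s, A x -> A y -> 0 < s -> s < 1 -> A (s *: x + (1 - s) *: y)) ->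
  @convex_set R V A.
Proof.
move=> hA; apply/convex_setW => x y /set_mem Ax /set_mem Ay k k0 k1.
by apply/mem_set; exact: hA.
Qed.

Lemma convex_set_comb A x y s : @convex_set R V A -> A x -> A y ->
  0 <= s -> s <= 1 -> A (s *: x + (1 - s) *: y).
Proof.
move=> cA Ax Ay s0 s1.
have s01 : Itv.spec (@Itv.num_sem R) (Itv.Real `[0, 1]%Z) s.
  by apply/andP; split; rewrite ?num_real//= in_itv/= s0.
by have := cA x y (Itv.mk s01) (mem_set Ax) (mem_set Ay) => /set_mem.
Qed.

Lemma convex_conv_hull A : @convex_set R V (conv_hull A).
Proof.
move=> x y s /set_mem hx /set_mem hy; apply/mem_set => B [cB AB].
by apply/set_mem/cB; apply/mem_set; [exact: hx|exact: hy].
Qed.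

Lemma conv_hull_gen A : A `<=` conv_hull A.
Proof. by move=> x Ax B [_]; apply. Qed.

Lemma conv_hull_min A B : @convex_set R V B -> A `<=` B -> conv_hull A `<=` B.
Proof. by move=> cB AB x; apply; split. Qed.

Lemma conv_hullS A B : A `<=` B -> conv_hull A `<=` conv_hull B.
Proof.
by move=> AB; apply: conv_hull_min; [exact: convex_conv_hull|
  exact: subset_trans AB (@conv_hull_gen B)].
Qed.

Lemma conv_hull0 : conv_hull (set0 : set V) = set0.
Proof. by apply/seteqP; split=> // x; apply: conv_hull_min => // a b s /set_mem. Qed.

Lemma scalar_form (g : V -> R) : GRing.linear_for *%R g ->
  exists G : {scalar V}, forall x, G x = g x.
Proof.
move=> gl; pose gL := GRing.isLinear.Build R V R *%R g gl.
by exists (HB.pack_for {scalar V} g gL).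
Qed.

Lemma form_sum (I : finType) (c : I -> {scalar V}) (a : I -> R) :
  exists g : {scalar V}, forall x, g x = \sum_i a i * c i x.
Proof.
apply: scalar_form => s x y; rewrite mulr_sumr -big_split; apply: eq_bigr => i _ /=.
by rewrite linearP/=; ring.
Qed.

Lemma affdim_eq0 A : affdim A = 0%N -> forall x y, A x -> A y -> x = y.
Proof.
move=> A0 x y Ax Ay; apply/eqP; rewrite -subr_eq0; apply: contraT => xy.
suff : (1 <= affdim A)%N by rewrite A0.
apply: (@affdim_ge _ _ _ _ (x - y : 'M_(1, m))).
  by rewrite /row_free rank_rV xy.
by move=> i; exists x, y; rewrite row_id.
Qed.

End ConvexHulls.

(** * Polytopes cut out by coordinates of unit width *)

(** Throughout this part a polytope is the set of points of a flat [A] at which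
    the finitely many affine functions [c i + e i] take values in [0, 1], and it
    is the hull of points [W] at which they take only the values 0 and 1. Then a
    vertex has lattice distance at most 1 from every facet, which is exactly what makes
    the recursion defining polytope numbers count lattice points of dilates. *)
Section UnitWidth.
Variables (R : realType) (m : nat) (I : finType).
Local Notation V := 'rV[R]_m.
Variables (A : set V) (c : I -> {scalar V}) (e : I -> R) (W : seq V).
Implicit Types (x y z w : V) (G : set V).

Local Notation f i x := (c i x + e i).

Definition slab : set V := [set x | A x /\ forall i, 0 <= f i x <= 1].

(** The smallest face of the polytope containing [x]: the constraints that are
    tight at [x] are imposed as equations. *)
Definition cell x : set V :=
  [set y | slab y /\ forall i, (f i x = 0 -> f i y = 0) /\ (f i x = 1 -> f i y = 1)].

Hypothesis A_line : forall x y s, A x -> A y -> A (x + s *: (x - y)).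
Hypothesis slab_hull : slab = conv_hull [set` W].
Hypothesis W01 : forall w i, w \in W -> f i w = 0 \/ f i w = 1.

Lemma coord_line i x y s : f i (x + s *: (x - y)) = f i x + s * (f i x - f i y).
Proof. by rewrite linearD linearZ linearB/=; ring. Qed.

Lemma coord_conv i x y s : f i (s *: x + (1 - s) *: y) = s * f i x + (1 - s) * f i y.
Proof. by rewrite linearD !linearZ/=; ring. Qed.

Lemma slab_conv x y s : slab x -> slab y -> 0 <= s -> s <= 1 ->
  slab (s *: x + (1 - s) *: y).
Proof.
by rewrite slab_hull => *; apply: convex_set_comb => //; exact: convex_conv_hull.
Qed.

Lemma cell_refl x : slab x -> cell x x.
Proof. by []. Qed.

Lemma cell_sub x y : cell x y -> cell y `<=` cell x.
Proof.
move=> [Py xy] z [Pz yz]; split=> // i; have [h0 h1] := xy i; have [k0 k1] := yz i.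
by split=> [/h0/k0|/h1/k1].
Qed.

Lemma cell_conv x y z s : cell x y -> cell x z -> 0 <= s -> s <= 1 ->
  cell x (s *: y + (1 - s) *: z).
Proof.
move=> [Py xy] [Pz xz] s0 s1; split; first exact: slab_conv.
move=> i; rewrite coord_conv; have [h0 h1] := xy i; have [k0 k1] := xz i.
by split=> [xi|xi]; [rewrite h0// k0//|rewrite h1// k1//]; ring.
Qed.

(** The sum of the coordinates that equal 1 at [x], minus the sum of those that
    equal 0 at [x], is maximal on the polytope exactly at the points of
    [cell x]. *)
Lemma cell_face x G : slab x -> cell x `<=` G -> G `<=` slab -> faces G (cell x).
Proof.
move=> Px xG GP; split; first by exists x.
pose a i : R := (f i x == 1)%:R - (f i x == 0)%:R.
have [g gE] := form_sum c a.
exists g.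
have gB y z : g y - g z = \sum_i a i * (f i y - f i z).
  by rewrite !gE -sumrB; apply: eq_bigr => i _; ring.
have a_ge y i : slab y -> 0 <= a i * (f i x - f i y).
  move=> [_ /(_ i)]; rewrite /a; case: eqP => [->|_]; case: eqP => [->|_];
  by rewrite ?oner_eq0/=; lra.
have gx y : slab y -> g y <= g x.
  by move=> Py; rewrite -subr_ge0 gB sumr_ge0// => i _; exact: a_ge.
apply/seteqP; split=> y.
  move=> xy; split; first exact: xG.
  move=> z /GP Pz; apply: le_trans (gx _ Pz) _.
  rewrite -subr_ge0 gB sumr_ge0// => i _; rewrite /a.
  have [_ /(_ i)[h0 h1]] := xy.
  by case: eqP => [x1|_]; case: eqP => [x0|_]; rewrite ?(h1 x1) ?(h0 x0) ?x1 ?x0; lra.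
move=> [Gy /(_ x)]; move/(_ (xG _ (cell_refl Px))) => xy.
have Py := GP _ Gy; split=> // i.
have : \sum_i a i * (f i x - f i y) == 0.
  by rewrite -gB subr_eq0 eq_le xy gx.
rewrite psumr_eq0 => [/allP/(_ i)|j _]; last exact: a_ge.
rewrite mem_index_enum => /(_ isT)/=/eqP; rewrite /a => ai.
split=> xi; move: ai; rewrite xi eqxx ?oner_eq0 1?eq_sym ?oner_eq0/=; lra.
Qed.

(** A face through [y] contains [cell y] because [y] lies in the relative
    interior of its cell: the segment from any [z] of the cell to [y] can be
    prolonged beyond [y]. *)
Lemma step_back y z : slab y -> cell y z ->
  exists2 s, 0 < s & slab (y + s *: (y - z)).
Proof.
move=> [Ay Py] [[Az Pz] yz].
pose h i := Num.min (f i y) (1 - f i y).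
pose s := \big[Num.min/1]_(i | 0 < f i y < 1) h i.
have s0 : 0 < s.
  apply/bigmin_gtP; split=> // i /andP[i0 i1].
  by rewrite lt_min i0 subr_gt0.
exists s => //; split; first exact: A_line.
move=> i; rewrite coord_line.
have /andP[y0 y1] := Py i; have /andP[z0 z1] := Pz i; have [h0 h1] := yz i.
have [yi|yi] := eqVneq (f i y) 0; first by rewrite yi h0//; lra.
have [yi'|yi'] := eqVneq (f i y) 1; first by rewrite yi' h1//; lra.
have yi01 : 0 < f i y < 1 by rewrite !lt_neqAle y0 y1 yi' eq_sym yi.
have : s <= h i by apply: bigmin_le_cond.
rewrite /h le_min => /andP[sy sy'].
apply/andP; split; nra.
Qed.

(** A face is the cell of any point of its relative interior; such a point is
    found by making the number of coordinates strictly between 0 and 1 as large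
    as possible. *)
Lemma face_cell x G : slab x -> faces (cell x) G ->
  exists2 y, cell x y & G = cell y.
Proof.
move=> Px [[y0 Gy0] [g GE]].
pose free y := [set i | 0 < f i y < 1]%SET.
pose Q n := `[< exists2 y, G y & #|free y| = n >].
have Q0 : exists n, Q n by exists #|free y0|; apply/asboolP; exists y0.
have Qb n : Q n -> (n <= #|I|)%N by move=> /asboolP[y _ <-]; exact: max_card.
have [n /asboolP[y Gy yn] nmax] := ex_maxnP Q0 Qb.
have GP : G `<=` cell x by rewrite GE => z [].
have xy := GP _ Gy; exists y => //; apply/seteqP; split=> z.
  move=> Gz; have xz := GP _ Gz; split; first by case: xz.
  (* The midpoint has at least the free coordinates of both ends. *)
  pose u := 2^-1 *: y + (1 - 2^-1) *: z.
  have Gu : G u.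
    move: Gy Gz; rewrite GE => -[_ gy] [_ gz].
    split; first by apply: cell_conv => //; lra.
    move=> t xt; rewrite linearD !linearZ/=.
    by have := gy _ xt; have := gz _ xt; lra.
  have fu i : f i u = 2^-1 * f i y + (1 - 2^-1) * f i z by rewrite coord_conv.
  have P01 t i : cell x t -> 0 <= f i t <= 1 by case=> -[].
  have yu : free y \subset free u.
    apply/fintype.subsetP => i; rewrite !inE fu => yi.
    by have := P01 z i xz; lra.
  have uy : free y = free u.
    apply/eqP; rewrite eqEcard yu/= yn; apply: nmax; apply/asboolP.
    by exists u.
  have hi i : (0 < f i u < 1) = (0 < f i y < 1).
    by have /setP/(_ i) := uy; rewrite !inE.
  move=> i; have := hi i; rewrite fu; have := P01 z i xz.
  move=> /andP[z0 z1] E; split=> yi; move: E; rewrite yi ?ltxx ?andbF ?andFb => /negbT;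
  rewrite negb_and -!leNgt => /orP[]; lra.
move=> yz.
have xz := cell_sub xy yz.
have [s s0 Pu] := step_back xy.1 yz.
move: Gy; rewrite GE => -[_ gy]; split=> // t /gy ty; apply: le_trans ty _.
have /gy : cell x (y + s *: (y - z)).
  split=> // i; rewrite coord_line.
  have [h0 h1] := xy.2 i; have [k0 k1] := xz.2 i.
  by split=> xi; [rewrite h0// k0//|rewrite h1// k1//]; ring.
rewrite linearD linearZ linearB/= gerDl pmulr_rle0// subr_le0; exact.
Qed.

(** If a point of the polytope is a proper convex combination of two others,
    then both of these lie in its cell. So the points [y] that are combinations
    of generators lying in [cell y] form a convex set, which contains the
    generators and is therefore the whole polytope. *)
Lemma cell_hull x : slab x -> cell x = conv_hull [set w | w \in W /\ cell x w].
Proof.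
move=> Px; apply/seteqP; split; last first.
  apply: conv_hull_min; last by move=> w [].
  by apply: convex_setP => y z s xy xz s0 s1; apply: cell_conv => //; exact: ltW.
pose T := [set y | slab y /\ conv_hull [set w | w \in W /\ cell y w] y].
have WP w : w \in W -> slab w by rewrite slab_hull; exact: conv_hull_gen.
have sl : slab `<=` T.
  rewrite {1}slab_hull; apply: conv_hull_min; last first.
    move=> w /= wW; split; first exact: WP.
    by apply: conv_hull_gen; split=> //; apply/cell_refl/WP.
  apply: convex_setP => y z s [Py yT] [Pz zT] s0 s1.
  have Pu : slab (s *: y + (1 - s) *: z) by apply: slab_conv => //; exact: ltW.
  split=> //.
  have sub t : cell (s *: y + (1 - s) *: z) t ->
      [set w | w \in W /\ cell t w] `<=`
      [set w | w \in W /\ cell (s *: y + (1 - s) *: z) w].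
    by move=> ut w [wW tw]; split=> //; exact: cell_sub tw.
  have [uy uz] : cell (s *: y + (1 - s) *: z) y /\ cell (s *: y + (1 - s) *: z) z.
    by split; split=> // i; have [_ /(_ i)] := Py; have [_ /(_ i)] := Pz;
      rewrite coord_conv => /andP[? ?] /andP[? ?]; split=> ?; nra.
  apply: convex_set_comb; rewrite ?ltW//; first exact: convex_conv_hull.
    exact: conv_hullS (sub _ uy) _ yT.
  exact: conv_hullS (sub _ uz) _ zT.
move=> y xy; have [_] := sl y xy.1; apply: conv_hullS => w [wW yw].
by split=> //; exact: cell_sub yw.
Qed.

Lemma cell_polytope x : slab x -> polytope (cell x).
Proof.
move=> Px; exists [seq w <- W | `[< cell x w >]].
have E : [set` [seq w <- W | `[< cell x w >]]] = [set w | w \in W /\ cell x w].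
  apply/seteqP; split=> w /=; rewrite mem_filter; first by case/andP => /asboolP.
  by move=> [wW xw]; rewrite wW andbT; apply/asboolP.
rewrite E -cell_hull//; split=> //.
apply/eqP => s0; have := cell_refl Px.
rewrite {1}cell_hull// -E s0.
suff -> : [set` ([::] : seq V)] = set0 by rewrite conv_hull0.
by apply/seteqP; split=> w.
Qed.

(** A vertex is its own cell, and a cell contains a generator. *)
Lemma cell_vertex x w : slab x -> vertices (cell x) w -> cell x w /\ w \in W.
Proof.
move=> Px vw; have [y xy wE] := face_cell Px vw.
have Py := xy.1.
have yw : y = w by have := cell_refl Py; rewrite -wE.
rewrite -yw; split=> //.
have := cell_refl Py; rewrite {1}cell_hull//.
apply: contraPT => yW.
suff -> : [set w0 | w0 \in W /\ cell y w0] = set0 by rewrite conv_hull0.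
apply/seteqP; split=> // w0 [w0W]; rewrite -wE => /= w0w.
by move: yW; rewrite yw -w0w w0W.
Qed.

(** An integer vector [a] stands for the point of the dilate of [G] by [t] that
    has the coordinates [a]; it is represented by the point of [G] itself. *)
Definition lattice_pt t G (a : {ffun I -> 'I_t.+1}) : Prop :=
  exists2 y, G y & forall i, t%:R * f i y = (a i)%:R.

(** The smallest face whose dilate by [t] contains the lattice point [a], read
    off from [a] when [t > 0]; see [carrierE]. *)
Definition carrier t (a : {ffun I -> 'I_t.+1}) : set V :=
  [set y | slab y /\ forall i,
    (a i = 0 :> nat -> f i y = 0) /\ (a i = t :> nat -> f i y = 1)].

Definition ehrhart t G : nat := #|[set a | `[< @lattice_pt t G a >]]%SET|.

(** Having [G] as carrier means to lie in the relative interior of the dilate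
    of [G]. *)
Definition ehrhart_int t G : nat :=
  #|[set a | `[< @lattice_pt t slab a /\ carrier a = G >]]%SET|.

Lemma carrierE t (a : {ffun I -> 'I_t.+1}) y : (0 < t)%N ->
  (forall i, t%:R * f i y = (a i)%:R) -> carrier a = cell y.
Proof.
move=> t0 ya; have tR : (t%:R : R) != 0 by rewrite pnatr_eq0 -lt0n.
have a0 i : (a i = 0 :> nat) <-> f i y = 0.
  split=> [ai|yi]; have := ya i; rewrite ?ai ?yi.
    by move=> /eqP; rewrite mulf_eq0 (negbTE tR)/= => /eqP.
  by rewrite mulr0 => /esym/eqP; rewrite pnatr_eq0 => /eqP.
have a1 i : (a i = t :> nat) <-> f i y = 1.
  split=> [ai|yi]; have := ya i; rewrite ?ai ?yi.
    by rewrite -[RHS]mulr1 => /(mulfI tR).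
  by rewrite mulr1 => /esym/eqP; rewrite eqr_nat => /eqP.
apply/seteqP; split=> z [Pz az]; split=> // i; have [h0 h1] := az i.
  by split=> [/a0/h0|/a1/h1].
by split=> [/a0/h0|/a1/h1].
Qed.

(** Only finitely many values [F] have a nonempty fiber, so the finitely supported
    sum is a genuine sum even when [D] is infinite. *)
Lemma sum_fibers (T : finType) (C : choiceType) (h : T -> C) (S : pred T) (D : set C) :
  \sum_(F \in D) (#|[set a | S a & h a == F]%SET|)%:Z =
  (#|[set a | S a & `[< D (h a) >]]%SET|)%:Z.
Proof.
pose r := undup [seq h a | a <- enum [set a | S a & `[< D (h a) >]]%SET].
have rP F : F \in r <-> exists2 a, S a & D F /\ h a = F.
  rewrite mem_undup; split=> [/mapP[a]|[a Sa [DF aF]]].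
    by rewrite mem_enum inE => /andP[Sa /asboolP Da] ->; exists a.
  by apply/mapP; exists a; rewrite // mem_enum inE Sa aF; apply/asboolP.
rewrite (@fsbigE _ _ _ _ _ r) ?undup_uniq//; first last.
- move=> F DF; apply: contraNeq => /=.
  rewrite eqz_nat -lt0n => /card_gt0P[a]; rewrite inE => /andP[Sa /eqP aF].
  by apply/rP; exists a.
- by move=> F /= /rP[a _ []].
have -> : \sum_(F <- r | F \in D) (#|[set a | S a & h a == F]%SET|)%:Z =
    \sum_(F <- r) \sum_(a | S a && `[< D (h a) >] && (h a == F)) (1 : int).
  rewrite big_seq_cond [RHS]big_seq; apply: eq_big => F.
    case: (boolP (F \in r)) => //= /rP[a _ [DF _]]; exact/mem_set.
  move=> /andP[/rP[a0 _ [DF _]] _]; rewrite sumr_const natz; congr Posz.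
  apply: eq_card => a; rewrite !inE unfold_in.
  case: eqP => [aF|]; rewrite ?andbF// aF !andbT.
  by case: asboolP => //; rewrite andbT.
rewrite (exchange_big_dep (fun a => S a && `[< D (h a) >]))/= => [|? ? _ /andP[]//].
rewrite -natz -sumr_const; apply: eq_big => [a|a Sa]; first by rewrite inE.
rewrite big_mkcond (bigD1_seq (h a)) ?undup_uniq//=; last first.
  by apply/rP; exists a; case/andP: Sa => // ? /asboolP.
rewrite Sa eqxx/= big1 ?addr0// => F aF.
by rewrite eq_sym (negbTE aF).
Qed.

Lemma cell_faceP t x (a : {ffun I -> 'I_t.+1}) : slab x -> (0 < t)%N ->
  lattice_pt (cell x) a <-> lattice_pt slab a /\ faces (cell x) (carrier a).
Proof.
move=> Px t0; split=> [[y xy ya]|[[y Py ya]]]; rewrite (carrierE t0 ya).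
  split; first by exists y => //; case: xy.
  by apply: cell_face (cell_sub xy) _; [case: xy|move=> z []].
move=> [_ [g gE]]; exists y => //.
by have := cell_refl Py; rewrite gE => -[].
Qed.

Lemma lattice_pt_face t x (a : {ffun I -> 'I_t.+1}) : slab x -> (0 < t)%N ->
  lattice_pt slab a -> carrier a = cell x -> lattice_pt (cell x) a.
Proof.
move=> Px t0 Pa ax; apply/cell_faceP => //; split=> //.
by rewrite ax; apply: cell_face => // z [].
Qed.

(** This is where unit width enters. Let [a] be a lattice point of the dilate
    by [t + 1] and [w] a 0/1 vertex. The point [a - w] is outside the dilate by
    [t] exactly when some coordinate of [a] is 0 where that of [w] is 1, or is
    [t + 1] where that of [w] is 0, which is to say that the carrier of [a]
    misses [w]. So the carriers containing [w] account for all lattice points of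
    the dilate by [t], and the increment in the recursion for polytope numbers
    consists of the carriers avoiding [w]. *)
Lemma lattice_shift t x w : slab x -> w \in W -> cell x w ->
  #|[set a : {ffun I -> 'I_t.+2} |
     `[< lattice_pt (cell x) a /\ carrier a w >]]%SET| = ehrhart t (cell x).
Proof.
move=> Px wW xw; have Pw := xw.1.
pose u i : nat := (f i w == 1).
have wu i : f i w = (u i)%:R.
  by rewrite /u; have [->|->] := W01 i wW; rewrite ?eqxx ?(eq_sym 0) ?oner_eq0.
pose h (b : {ffun I -> 'I_t.+1}) : {ffun I -> 'I_t.+2} := [ffun i => inord (b i + u i)].
have hE b i : h b i = (b i + u i)%N :> nat.
  rewrite ffunE inordK//; have := ltn_ord (b i); have : (u i <= 1)%N := leq_b1 _.
  lia.
have h_inj : injective h.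
  move=> b b' bb'; apply/ffunP => i; apply/ord_inj/eqP.
  by rewrite -(eqn_add2r (u i)) -!hE bb'.
rewrite /ehrhart -(card_imset _ h_inj); apply: eq_card => a; rewrite !inE.
have slab01 z i : slab z -> 0 <= f i z <= 1 by case.
apply/asboolP/imsetP => [[[y xy ya]]|[b]].
  rewrite (carrierE _ ya)// => -[_ yw]; have Py := xy.1.
  have ua i : (u i <= a i)%N.
    rewrite /u; case: eqP => // w1; rewrite lt0n; apply/eqP => a0.
    have : f i y = 0.
      by have /eqP := ya i; rewrite a0 mulf_eq0 pnatr_eq0/= => /eqP.
    by move=> /(yw i).1; rewrite w1 => /eqP; rewrite oner_eq0.
  have au i : (a i <= t + u i)%N.
    rewrite /u; case: eqP => [_|w1]; first by have := ltn_ord (a i); lia.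
    rewrite addn0 -ltnS ltn_neqAle -ltnS ltn_ord andbT.
    apply/eqP => at1; apply: w1; apply: (yw i).2.
    have := ya i; rewrite at1 -[RHS]mulr1 => /mulfI; apply.
    by rewrite pnatr_eq0.
  pose b : {ffun I -> 'I_t.+1} := [ffun i => inord (a i - u i)].
  have bE i : b i = (a i - u i)%N :> nat.
    by rewrite ffunE inordK//; have := au i; lia.
  exists b; last first.
    by apply/ffunP => i; apply: ord_inj; rewrite hE bE subnK.
  rewrite inE; apply/asboolP.
  (* For t = 0 the inverse is 0, and the point is y. *)
  exists (y + t%:R^-1 *: (y - w)); last first.
    move=> i; rewrite coord_line bE natrB// -ya -wu.
    case: (posnP t) => [t0|t0].
      have : (a i)%:R = (u i)%:R :> R.
        by congr _%:R; have := au i; have := ua i; move: (a i : nat) => ai; lia.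
      by rewrite -ya -wu t0 => <-; ring.
    by rewrite mulrDr mulrA mulfV ?pnatr_eq0 -?lt0n// -[t.+1]addn1 natrD; ring.
  case: (posnP t) => [->|t0]; first by rewrite invr0 scale0r addr0.
  split; last first.
    move=> i; rewrite coord_line.
    have [h0 h1] := xy.2 i; have [k0 k1] := xw.2 i.
    by split=> xi; [rewrite h0// k0//|rewrite h1// k1//]; ring.
  split; first by apply: A_line; [exact: Py.1|exact: Pw.1].
  move=> i; have tR : 0 < (t%:R : R) by rewrite ltr0n.
  have -> : f i (y + t%:R^-1 *: (y - w)) = (b i)%:R / t%:R.
    rewrite coord_line bE natrB// -ya -wu -[t.+1]addn1 natrD.
    by field; rewrite gt_eqF.
  rewrite divr_ge0//= ler_pdivrMr// mul1r ler_nat -ltnS; exact: ltn_ord.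
rewrite inE => /asboolP[y xy yb] ->.
have t1R : 0 < (t.+1%:R : R) by rewrite ltr0n.
pose s : R := t%:R / t.+1%:R.
have s0 : 0 <= s by rewrite divr_ge0.
have s1 : s <= 1 by rewrite ler_pdivrMr// mul1r ler_nat.
have sE : 1 - s = t.+1%:R^-1.
  by rewrite /s -[t.+1]addn1 natrD; field; rewrite -natr1 in t1R; rewrite gt_eqF.
pose z := s *: y + (1 - s) *: w.
have xz : cell x z by exact: cell_conv.
have zE i : t.+1%:R * f i z = (h b i)%:R.
  rewrite coord_conv hE natrD -yb -wu sE /s.
  by field; rewrite gt_eqF.
split; first by exists z.
rewrite (carrierE _ zE)//; split=> // i.
have t10 : t.+1%:R != 0 :> R by rewrite gt_eqF.
have := zE i; rewrite hE wu => zi.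
split=> fz; move: zi; rewrite fz.
  rewrite mulr0 => /esym/eqP; rewrite pnatr_eq0 addn_eq0 => /andP[_ /eqP ->] //.
rewrite mulr1 => /eqP; rewrite eqr_nat => /eqP tbu; rewrite (_ : u i = 1%N)//.
have := ltn_ord (b i); have : (u i <= 1)%N := leq_b1 _; move: tbu.
by move: (nat_of_ord (b i)) (u i) => p q; lia.
Qed.

Lemma sum_ehrhart_int t (D : set (set V)) :
  \sum_(F \in D) (ehrhart_int t F)%:Z =
  (#|[set a | `[< @lattice_pt t slab a /\ D (carrier a) >]]%SET|)%:Z.
Proof.
pose S (a : {ffun I -> 'I_t.+1}) := `[< lattice_pt slab a >].
transitivity (\sum_(F \in D) (#|[set a | S a & @carrier t a == F]%SET|)%:Z).
  apply: eq_fsbigr => F _; congr Posz; apply: eq_card => a; rewrite !inE.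
  by apply/asboolP/andP => [[? ->]|[/asboolP ? /eqP]]; split=> //; apply/asboolP.
rewrite sum_fibers; congr Posz; apply: eq_card => a; rewrite !inE.
by apply/andP/asboolP => [[/asboolP ? /asboolP]//|[? ?]]; split; apply/asboolP.
Qed.

(** The dilate by 0 is a single point, in accordance with [P(1) = 1]. *)
Lemma ehrhart0 x : slab x -> ehrhart 0 (cell x) = 1%N.
Proof.
move=> Px; rewrite /ehrhart -[RHS](@card1 {ffun I -> 'I_1} [ffun=> ord0]).
apply: eq_card => a; rewrite !inE; have -> : a = [ffun=> ord0].
  by apply/ffunP => i; rewrite ffunE; exact: ord1.
rewrite eqxx; apply/asboolP; exists x => // i.
by rewrite ffunE mul0r.
Qed.

(** The polytope numbers of a polytope of unit width are the values of its
    Ehrhart function, with argument shifted by one, and the interior numbers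
    count the interior lattice points of the same dilates. Every lattice point
    of a dilate lies in the relative interior of exactly one face, so the sums
    over faces in the recursion add up cardinals of disjoint sets; the claim is
    proved for all faces simultaneously by induction on the dimension. It holds
    whichever vertex is distinguished in each face. *)
Lemma cell_numbers (v : set V -> V) x t : vertex_choice v -> slab x ->
  pnum v (cell x) t.+1 = (ehrhart t (cell x))%:Z /\
  ((0 < t)%N -> inum v (cell x) t.+1 = (ehrhart_int t (cell x))%:Z).
Proof.
move=> vP; move: {-1}(affdim _) (erefl (affdim (cell x))) => n.
elim/ltn_ind: n x t => n IH x t xn Px.
have [xw wW] := cell_vertex Px (vP _ (cell_polytope Px)).
set w := v (cell x) in xw wW.
have [n0|n0] := posnP n.
  have x1 : cell x = [set x].
    apply/seteqP; split=> y; last by move=> ->; exact: cell_refl.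
    by move=> xy; apply: affdim_eq0 xy (cell_refl Px); rewrite xn.
  have wx : w = x by move: xw; rewrite x1.
  have e1 : ehrhart t (cell x) = 1%N.
    rewrite /ehrhart.
    pose a0 : {ffun I -> 'I_t.+1} := [ffun i => if f i w == 1 then ord_max else ord0].
    have a0E i : t%:R * f i x = (a0 i)%:R.
      rewrite -wx ffunE; have [->|->] := W01 i wW.
        by rewrite mulr0 eq_sym oner_eq0.
      by rewrite mulr1 eqxx.
    rewrite -[RHS](@card1 {ffun I -> 'I_t.+1} a0).
    apply: eq_card => a; rewrite !inE; apply/asboolP/eqP => [[y]|->].
      rewrite x1 => -> xa; apply/ffunP => i; apply/val_inj/eqP.
      by rewrite -(eqr_nat R) -xa a0E.
    by exists x; rewrite ?x1.
  rewrite pnum_dim0 ?inum_dim0 ?xn// e1; split=> // t0; rewrite -[LHS]/(Posz 1) -e1.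
  congr Posz; rewrite /ehrhart /ehrhart_int; apply: eq_card => a; rewrite !inE.
  apply/asboolP/asboolP => [[y xy ya]|[Pa ax]]; last exact: lattice_pt_face.
  split; first by exists y => //; case: xy.
  by rewrite (carrierE t0 ya); move: xy; rewrite x1 => ->.
have {}IH F s : (0 < s)%N -> faces (cell x) F -> F <> cell x ->
    inum v F s.+1 = (ehrhart_int s F)%:Z.
  move=> s0 xF Fx; have [y xy FE] := face_cell Px xF.
  rewrite FE; apply: (IH _ _ y s erefl xy.1).2 => //.
  by rewrite -xn -FE; exact: affdim_face.
have pE : pnum v (cell x) t.+1 = (ehrhart t (cell x))%:Z.
  elim: t => [|t IHt]; first by rewrite pnum_1 ehrhart0.
  rewrite pnum_rec ?xn// IHt -(lattice_shift t Px wW xw).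
  rewrite (eq_fsbigr (fun F => (ehrhart_int t.+1 F)%:Z)); last first.
    by move=> F /set_mem[xF Fw]; apply: IH => // FE; apply: Fw; rewrite FE.
  rewrite sum_ehrhart_int -PoszD [in RHS]/ehrhart; congr Posz.
  rewrite -(cardsID [set a | `[< carrier a w >]]%SET
                    [set a | `[< @lattice_pt t.+1 (cell x) a >]]%SET).
  congr (_ + _)%N; apply: eq_card => a; rewrite !inE; last first.
    apply/asboolP/andP => [[Pa [xa aw]]|[/asboolP aw /asboolP/cell_faceP[]//]].
    by split; apply/asboolP => //; apply/cell_faceP.
  by apply/asboolP/andP => [[? ?]|[/asboolP ? /asboolP ?]]; split=> //; apply/asboolP.
split=> // t0.
rewrite inum_rec ?xn// pE.
rewrite (eq_fsbigr (fun F => (ehrhart_int t F)%:Z)); last first.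
  by move=> F /set_mem[xF FE]; exact: IH.
rewrite sum_ehrhart_int; apply/eqP; rewrite subr_eq -PoszD eqz_nat.
rewrite [eqbLHS]/ehrhart -(cardsID [set a | `[< carrier a = cell x >]]%SET).
apply/eqP; congr (_ + _)%N; apply: eq_card => a; rewrite !inE.
  apply/andP/asboolP => [[/asboolP/cell_faceP[]// Pa _ /asboolP]//|[Pa ax]].
  by split; apply/asboolP => //; exact: lattice_pt_face.
apply/andP/asboolP => [[/asboolP aw /asboolP/cell_faceP[]//]|[Pa [xa ax]]].
by split; apply/asboolP => //; apply/cell_faceP.
Qed.

End UnitWidth.

(** * Counting functions with bounded values and given sum *)

(** The generating polynomial of the integers below [b]. *)
Definition geom b : {poly int} := \sum_(s < b) 'X^s.

(** The number of ways to write [M] as an ordered sum of [N] natural numbers: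
    below degree [M + 1] the polynomial [geom M.+1] agrees with the geometric
    series. *)
Definition compositions N M : int := (geom M.+1 ^+ N)`_M.

(** Expanding the power gives one monomial for each function [a]. *)
Lemma card_sum_coef (I : finType) b (D : pred nat) M :
  (#|[set a : {ffun I -> 'I_b} |
     (\sum_i a i == M)%N && [forall i, D (a i)]]%SET|)%:Z =
  ((\sum_(s < b | D s) 'X^s : {poly int}) ^+ #|I|)`_M.
Proof.
rewrite -prodr_const bigA_distr_big coef_sum -natz -sumr_const.
rewrite [RHS]big_mkcond [LHS]big_mkcond; apply: eq_bigr => a _.
rewrite inE -expr_sum coefXn eq_sym.
have -> : (a \in ffun_on (fun s : 'I_b => D s)) = [forall i, D (a i)].
  by apply/ffun_onP/forallP.
by case: eqP; case: forallP.
Qed.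

Lemma coef_mul_trunc (P : {poly int}) c N M : (M < c)%N ->
  (P * (1 - 'X^c) ^+ N)`_M = P`_M.
Proof.
move=> Mc; pose Q : {poly int} := \sum_(i < N) (1 - 'X^c) ^+ i.
have -> : (1 - 'X^c) ^+ N = 1 - 'X^c * Q.
  have := subrX1 (1 - 'X^c : {poly int}) N; rewrite -/Q => E.
  by rewrite -[LHS](subrK 1) E addrAC subrr add0r mulNr addrC.
by rewrite mulrBr mulr1 coefB mulrCA coefXnM Mc subr0.
Qed.

(** Up to degree [B] the power series identity
    [(1 + X + ... + X^(b-1)) = (1 - X^b) / (1 - X)] can be stated with
    [geom B] in place of [1 / (1 - X)]. *)
Lemma coef_trunc B b N M : (M < B)%N ->
  (geom b ^+ N)`_M = (geom B ^+ N * (1 - 'X^b) ^+ N)`_M.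
Proof.
move=> MB.
have geomE c : geom c * (1 - 'X) = 1 - 'X^c :> {poly int}.
  by rewrite mulrC -opprB mulNr -subrX1 opprB.
have -> : geom B ^+ N * (1 - 'X^b) ^+ N = geom b ^+ N * (1 - 'X^B) ^+ N.
  by rewrite -!geomE !exprMn mulrCA.
by rewrite coef_mul_trunc.
Qed.

Lemma coef_geom_stable B N M : (M < B)%N -> (geom B ^+ N)`_M = compositions N M.
Proof.
by move=> MB; rewrite /compositions (@coef_trunc B M.+1 N M MB) coef_mul_trunc.
Qed.

(** Inclusion-exclusion over the set of entries that are at least [b], in the
    form of the binomial expansion of [(1 - X^b)^N]. *)
Lemma coef_geom b N M : (geom b ^+ N)`_M =
  \sum_(j < N.+1) (-1) ^+ j * 'C(N, j)%:Z *
     seq_at (compositions N) (M%:Z - b%:Z * j%:Z).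
Proof.
rewrite (@coef_trunc M.+1)// exprBn mulr_sumr coef_sum; apply: eq_bigr => j _.
rewrite expr1n mulr1 -exprM mulrnAr coefMn mulrCA.
have -> : ((-1) ^+ j * (geom M.+1 ^+ N * 'X^(b * j)))`_M =
   (-1) ^+ j * (geom M.+1 ^+ N * 'X^(b * j))`_M.
  by rewrite -[in LHS]signr_odd -[in RHS]signr_odd; case: (odd j) => /=;
  rewrite ?expr1 ?mulN1r ?coefN// ?expr0 ?mul1r.
rewrite coefMXn -mulr_natr natz mulrAC.
apply: (congr1 (fun x => _ * x)); case: ltnP => bM.
  have : M%:Z - b%:Z * j%:Z < 0 by lia.
  by case: (_ - _).
rewrite -PoszM subzn// /seq_at coef_geom_stable// ltnS; exact: leq_subr.
Qed.

Lemma sum_rev_trunc r N (F : nat -> int) : (r <= N)%N ->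
  (forall j, (r < j)%N -> F j = 0) ->
  \sum_(j < N.+1) F j = \sum_(i < r.+1) F (r - i)%N.
Proof.
move=> rN F0; rewrite [RHS](reindex_inj rev_ord_inj)/=.
under [RHS]eq_bigr => i _ do rewrite subSS (subKn (ltn_ord i : (i <= r)%N)).
rewrite [RHS](big_ord_widen N.+1 F) ?ltnS// [RHS]big_mkcond; apply: eq_bigr => i _.
by case: ltnP => // /F0.
Qed.

(** * Hypersimplices *)

(** The points [p] are affinely independent; this is expressed by affine forms
    [c i + e i] dual to them, normalised to take the value [k] at [p i], so that
    the centers of the [k]-subsets of the points have coordinates 0 and 1. *)
Section Hypersimplex.
Variables (R : realType) (m d k : nat).
Local Notation V := 'rV[R]_m.
Variables (p : 'I_d.+1 -> V) (c : 'I_d.+1 -> {scalar V}) (e : 'I_d.+1 -> R).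
Implicit Types (x y : V) (i j : 'I_d.+1).

Local Notation f i x := (c i x + e i).

Hypothesis k_gt0 : (0 < k)%N.
Hypothesis dual_pt : forall i j, f i (p j) = k%:R * (i == j)%:R.

Definition weighted_pt (y : 'I_d.+1 -> R) : V := k%:R^-1 *: \sum_i y i *: p i.

Definition subset_center (K : {set 'I_d.+1}) : V :=
  weighted_pt (fun i => (i \in K)%:R).

(** The affine hull of the points [p], on which the coordinates add up to [k]. *)
Definition affine_span : set V :=
  [set x | x = weighted_pt (fun i => f i x) /\ \sum_i f i x = k%:R].

Definition subset_centers : seq V :=
  [seq subset_center K | K <- enum [set K : {set 'I_d.+1} | #|K| == k]%SET].

Definition hypersimplex : set V := slab affine_span c e.

Let kR : k%:R != 0 :> R. Proof. by rewrite pnatr_eq0 -lt0n. Qed.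

Lemma coord_pt (y : 'I_d.+1 -> R) i : \sum_j y j = k%:R ->
  f i (weighted_pt y) = y i.
Proof.
move=> yk; rewrite linearZ/= linear_sum/=.
have -> : \sum_j c i (y j *: p j) = k%:R * y i - (\sum_j y j) * e i.
  rewrite [in RHS]mulr_suml (bigD1 i)//= [in RHS](bigD1 i)//=.
  rewrite linearZ/= opprD addrA; congr (_ + _).
    by rewrite -[c i (p i)](addrK (e i)) dual_pt eqxx/=; ring.
  rewrite -sumrN; apply: eq_bigr => j ji.
  by rewrite linearZ/= -[c i (p j)](addrK (e i)) dual_pt eq_sym (negbTE ji)/=; ring.
by rewrite yk; field.
Qed.

Lemma affine_span_pt (y : 'I_d.+1 -> R) : \sum_j y j = k%:R ->
  affine_span (weighted_pt y).
Proof.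
move=> yk; split; last by rewrite -yk; apply: eq_bigr => i _; exact: coord_pt.
by congr (_ *: _); apply: eq_bigr => i _; rewrite coord_pt.
Qed.

Lemma affine_span_line x y s : affine_span x -> affine_span y ->
  affine_span (x + s *: (x - y)).
Proof.
move=> [xE xk] [yE yk].
pose u i := f i x + s * (f i x - f i y).
have -> : x + s *: (x - y) = weighted_pt u.
  rewrite {1 2}xE {1}yE /weighted_pt -scalerBr scalerA [s * _]mulrC -scalerA -scalerDr.
  congr (_ *: _); rewrite -sumrB scaler_sumr -big_split; apply: eq_bigr => i _ /=.
  by rewrite -scalerBl scalerA -scalerDl.
by apply: affine_span_pt; rewrite big_split/= -mulr_sumr sumrB xk yk; ring.
Qed.

Lemma subset_centersP x : reflect
  (exists2 K : {set 'I_d.+1}, #|K| = k & x = subset_center K)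
  (x \in subset_centers).
Proof.
apply: (iffP mapP) => -[K]; first by rewrite mem_enum inE => /eqP; exists K.
by exists K; rewrite // mem_enum inE; apply/eqP.
Qed.

Lemma sum_indicator (K : {set 'I_d.+1}) : \sum_i (i \in K)%:R = #|K|%:R :> R.
Proof.
rewrite -sum1_card natr_sum [RHS]big_mkcond.
by apply: eq_bigr => i _; case: (i \in K).
Qed.

Lemma subset_centers01 x i : x \in subset_centers -> f i x = 0 \/ f i x = 1.
Proof.
move=> /subset_centersP[K Kk ->]; rewrite coord_pt ?sum_indicator ?Kk//.
by case: (i \in K); [right|left].
Qed.

Lemma hypersimplex_center (K : {set 'I_d.+1}) : #|K| = k ->
  hypersimplex (subset_center K).
Proof.
move=> Kk; have Ks : \sum_i (i \in K)%:R = k%:R :> R by rewrite sum_indicator Kk.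
split; first exact: affine_span_pt.
by move=> i; rewrite coord_pt//; case: (i \in K); rewrite ?lexx ?ler01.
Qed.

Let free x := [set i | 0 < f i x < 1]%SET.

(* The translate of x by s in the direction of p i - p j. *)
Let slide x i j s := weighted_pt (fun l => f l x + s * ((l == i)%:R - (l == j)%:R)).

Lemma slide_sum x i j s : affine_span x ->
  \sum_l (f l x + s * ((l == i)%:R - (l == j)%:R)) = k%:R.
Proof.
move=> [_ xk]; rewrite big_split/= xk -mulr_sumr sumrB.
have h n : \sum_l (l == n :> 'I_d.+1)%:R = 1 :> R.
  by rewrite (bigD1 n)//= eqxx big1 ?addr0// => l /negbTE ->.
by rewrite !h subrr mulr0 addr0.
Qed.

(** Moving in the direction [p i - p j] changes two free coordinates only, and
    can be continued until one of them reaches 0 or 1. *)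
Lemma slide_free x i j : hypersimplex x -> i != j -> 0 < f i x < 1 -> 0 < f j x < 1 ->
  exists2 s, 0 < s & hypersimplex (slide x i j s) /\
    (#|free (slide x i j s)| < #|free x|)%N.
Proof.
move=> [Ax x01] ij /andP[i0 i1] /andP[j0 j1].
pose s := Num.min (1 - f i x) (f j x).
have s0 : 0 < s by rewrite lt_min subr_gt0 i1.
have [si sj] : s <= 1 - f i x /\ s <= f j x.
  by apply/andP; rewrite -le_min.
exists s => //.
have sl l := coord_pt l (slide_sum i j s Ax).
have fi : f i (slide x i j s) = f i x + s by rewrite sl eqxx (negbTE ij)/=; ring.
have fj : f j (slide x i j s) = f j x - s by rewrite sl eqxx eq_sym (negbTE ij)/=; ring.
have fl l : l != i -> l != j -> f l (slide x i j s) = f l x.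
  by move=> li lj; rewrite sl (negbTE li) (negbTE lj)/=; ring.
have H : hypersimplex (slide x i j s).
  split; first exact/affine_span_pt/slide_sum.
  move=> l; have [->|li] := eqVneq l i; first by rewrite fi; lra.
  have [->|lj] := eqVneq l j; first by rewrite fj; lra.
  by rewrite fl.
split=> //; apply: proper_card; apply/properP; split.
  apply/fintype.subsetP => l; rewrite !inE.
  have [->|li] := eqVneq l i; first by rewrite i0 i1.
  have [->|lj] := eqVneq l j; first by rewrite j0 j1.
  by rewrite fl.
have : s = 1 - f i x \/ s = f j x by rewrite /s; case: leP => _; [left|right].
case=> sE; [exists i|exists j]; rewrite !inE ?i0 ?i1 ?j0 ?j1//.
  by rewrite fi sE addrC subrK ltxx andbF.
by rewrite fj sE subrr ltxx.
Qed.

(** The coordinates add up to an integer, so a single one cannot be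
    fractional. *)
Lemma free_pair x i : hypersimplex x -> 0 < f i x < 1 ->
  exists2 j, i != j & 0 < f j x < 1.
Proof.
move=> [[_ xk] x01] /andP[i0 i1]; apply: contrapT => h.
pose u l : nat := (f l x == 1).
have xu l : l != i -> f l x = (u l)%:R.
  move=> li; rewrite /u; case: eqVneq => // l1.
  apply/eqP; apply: contraT => l0; case: h; exists l; first by rewrite eq_sym.
  by have := x01 l; rewrite !lt_neqAle eq_sym l0 l1.
move: xk; rewrite (bigD1 i)//= (eq_bigr _ xu) -natr_sum => xk.
set n := (\sum_(_ < _ | _) _)%N in xk.
have : (n%:R : R) < k%:R by lra.
have : (k%:R : R) < n.+1%:R by rewrite -natr1; lra.
by rewrite !ltr_nat ltnS => /leq_ltn_trans /[apply]; rewrite ltnn.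
Qed.

(** Integrality of the hypersimplex. A point with a fractional coordinate has
    two of them; sliding both ways along the corresponding edge direction
    exhibits it as a convex combination of two points with fewer fractional
    coordinates. *)
Lemma hypersimplex_hull : hypersimplex = conv_hull [set` subset_centers].
Proof.
apply/seteqP; split=> x; last first.
  apply: conv_hull_min => [|y /subset_centersP[K Kk ->]]; last first.
    exact: hypersimplex_center.
  apply: convex_setP => y z s [Ay y01] [Az z01] s0 s1; split.
    have -> : s *: y + (1 - s) *: z = y + (s - 1) *: (y - z).
      by apply/rowP => l; rewrite !mxE; ring.
    exact: affine_span_line.
  move=> i; rewrite coord_conv; have := y01 i; have := z01 i.
  by move=> /andP[? ?] /andP[? ?]; apply/andP; split; nra.
move: {2}#|free x| (leqnn #|free x|) => n; elim: n x => [|n IHn] x xn Hx.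
  have [xE xk] := Hx.1.
  have f0 i : f i x = (f i x == 1)%:R.
    case: eqVneq => // i1; apply/eqP; apply: contraT => i0.
    have x0 : #|free x| = 0%N by apply/eqP; rewrite -leqn0.
    suff : i \in free x by rewrite (cards0_eq x0) inE.
    by rewrite inE; have := Hx.2 i; rewrite !lt_neqAle eq_sym i0 i1.
  apply: conv_hull_gen; apply/subset_centersP.
  exists [set i | f i x == 1]%SET.
    apply/eqP; rewrite -(eqr_nat R) -sum_indicator -xk; apply/eqP.
    by apply: eq_bigr => i _; rewrite inE [RHS]f0.
  by rewrite {1}xE; congr (_ *: _); apply: eq_bigr => i _; rewrite inE {1}f0.
have [f0|[i]] := set_0Vmem (free x).
  by apply: IHn Hx; rewrite f0 cards0.
rewrite inE => xi; have [j ij xj] := free_pair Hx xi.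
have [a a0 [Ha an]] := slide_free Hx ij xi xj.
have ji : j != i by rewrite eq_sym.
have [b b0 [Hb bn]] := slide_free Hx ji xj xi.
have ab : a + b != 0 by rewrite gt_eqF// addr_gt0.
have -> : x = (b / (a + b)) *: slide x i j a + (1 - b / (a + b)) *: slide x j i b.
  rewrite {1}Hx.1.1 /slide /weighted_pt !scalerA ![_ * k%:R^-1]mulrC.
  rewrite -!scalerA -scalerDr.
  congr (_ *: _); rewrite !scaler_sumr -big_split; apply: eq_bigr => l _ /=.
  by rewrite !scalerA -scalerDl; congr (_ *: _); field.
apply: convex_set_comb; first exact: convex_conv_hull.
- by apply: IHn Ha; rewrite -ltnS; exact: leq_trans an _.
- by apply: IHn Hb; rewrite -ltnS; exact: leq_trans bn _.
- by rewrite divr_ge0 ?addr_ge0// ltW.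
- by rewrite ler_pdivrMr ?addr_gt0// mul1r lerDr ltW.
Qed.

Lemma hypersimplex_lattice t (a : {ffun 'I_d.+1 -> 'I_t.+2}) :
  lattice_pt c e hypersimplex a <-> (\sum_i a i = k * t.+1)%N.
Proof.
have tR : t.+1%:R != 0 :> R by rewrite pnatr_eq0.
split=> [[y [[_ yk] _] ya]|ak].
  apply/eqP; rewrite -(eqr_nat R) natrM -yk natr_sum mulrC mulr_sumr.
  by apply/eqP/eq_bigr => i _; rewrite ya.
have yk : \sum_i (a i)%:R / t.+1%:R = k%:R :> R.
  by rewrite -mulr_suml -natr_sum ak natrM mulfK.
exists (weighted_pt (fun i => (a i)%:R / t.+1%:R)).
  split; first exact: affine_span_pt.
  move=> i; rewrite coord_pt// divr_ge0//= ler_pdivrMr ?ltr0n//.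
  by rewrite mul1r ler_nat -ltnS; exact: ltn_ord.
by move=> i; rewrite coord_pt// mulrC divfK.
Qed.

Hypothesis k_led : (k <= d)%N.

(* All coordinates of the barycenter are equal, hence strictly between 0 and 1
   as 0 < k < d + 1; so its cell is the whole hypersimplex. *)
Let mid : V := weighted_pt (fun=> k%:R / d.+1%:R).

Let mid_sum : \sum_(i < d.+1) k%:R / d.+1%:R = k%:R :> R.
Proof. by rewrite sumr_const card_ord -[LHS]mulr_natr divfK// pnatr_eq0. Qed.

Let midE i : f i mid = k%:R / d.+1%:R.
Proof. by rewrite coord_pt. Qed.

Let mid01 i : 0 < f i mid < 1.
Proof.
by rewrite midE divr_gt0 ?ltr0n//= ltr_pdivrMr ?ltr0n// mul1r ltr_nat ltnS.
Qed.

Let mid_in : hypersimplex mid.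
Proof.
split; first exact: affine_span_pt.
by move=> i; have /andP[? ?] := mid01 i; rewrite !ltW.
Qed.

Let mid_cell : hypersimplex = cell affine_span c e mid.
Proof.
apply/seteqP; split=> x; last by case.
move=> Hx; split=> // i.
by split=> mi; move: (mid01 i); rewrite mi ?ltxx ?andbF.
Qed.

Lemma hypersimplex_cell :
  exists2 x, hypersimplex x & hypersimplex = cell affine_span c e x.
Proof. by exists mid; [exact: mid_in|exact: mid_cell]. Qed.

Let mid_numbers (v : set V -> V) t : vertex_choice v ->
  pnum v hypersimplex t.+2 = (ehrhart c e t.+1 hypersimplex)%:Z /\
  inum v hypersimplex t.+2 = (ehrhart_int affine_span c e t.+1 hypersimplex)%:Z.
Proof.
move=> vP; have [] := cell_numbers affine_span_line hypersimplex_hull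
  (fun x i => @subset_centers01 x i) t.+1 vP mid_in.
by rewrite -mid_cell => -> /(_ isT) ->.
Qed.

Lemma hypersimplex_pnum (v : set V -> V) t : vertex_choice v ->
  pnum v hypersimplex t.+1 = (geom t.+1 ^+ d.+1)`_(k * t).
Proof.
case: t => [|t] vP; first by rewrite pnum_1 muln0 /geom big_ord1 expr0 expr1n coef1.
have cardC := @card_sum_coef 'I_d.+1 t.+2 predT (k * t.+1).
rewrite card_ord in cardC.
rewrite (mid_numbers t vP).1 /geom -cardC; congr Posz.
apply: eq_card => a; rewrite !inE.
apply/asboolP/andP => [/hypersimplex_lattice/eqP ak|[/eqP/hypersimplex_lattice]//].
by split=> //; apply/forallP.
Qed.

Lemma hypersimplex_inum (v : set V -> V) t : vertex_choice v ->
  inum v hypersimplex t.+2 = (('X * geom t) ^+ d.+1)`_(k * t.+1).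
Proof.
move=> vP; rewrite (mid_numbers t vP).2.
have -> : 'X * geom t = \sum_(s < t.+2 | (0 < s < t.+1)%N) 'X^s.
  rewrite big_mkcond big_ord_recl big_ord_recr/= ltnn add0r addr0.
  rewrite /geom mulr_sumr; apply: eq_bigr => s _.
  by rewrite /bump/= add1n ltnS ltn_ord exprS.
have cardC := @card_sum_coef 'I_d.+1 t.+2 (fun s => 0 < s < t.+1)%N (k * t.+1).
rewrite card_ord in cardC.
rewrite -cardC; congr Posz; apply: eq_card => a; rewrite !inE.
apply/asboolP/andP => [[/hypersimplex_lattice/eqP ak aH]|].
  split=> //; apply/forallP => i.
  have : carrier affine_span c e a mid by rewrite aH.
  move=> [_ /(_ i)[h0 h1]]; have := mid01 i.
  rewrite lt0n ltn_neqAle -ltnS ltn_ord andbT.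
  apply: contraLR; rewrite negb_and !negbK => /orP[/eqP/h0|/eqP/h1] ->;
  by rewrite ltxx ?andbF.
move=> [/eqP ak /forallP a01]; split; first exact/hypersimplex_lattice.
apply/seteqP; split=> x; first by case.
move=> Hx; split=> // i; have := a01 i.
by split=> ai; move: (a01 i); rewrite ai// ltnn andbF.
Qed.

Lemma hypersimplex_dim_gt0 (v : set V -> V) : vertex_choice v ->
  (0 < affdim hypersimplex)%N.
Proof.
move=> vP; rewrite lt0n; apply/eqP => /affdim_eq0 H0.
have vW : v hypersimplex \in subset_centers /\ hypersimplex (v hypersimplex).
  have := cell_polytope hypersimplex_hull mid_in.
  move=> /vP /(cell_vertex affine_span_line hypersimplex_hull mid_in).
  by rewrite -mid_cell => -[].
have := mid01 ord0; rewrite (H0 _ _ mid_in vW.2).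
by have [->|->] := subset_centers01 ord0 vW.1; rewrite ltxx ?andbF.
Qed.

End Hypersimplex.

(** * Faces of a simplex and rectification *)

(** For [k = 1] the coordinates are barycentric coordinates, and the hypersimplex
    is the simplex with vertices [p]. *)
Section Simplex.
Variables (R : realType) (m d : nat).
Local Notation V := 'rV[R]_m.
Variables (p : 'I_d.+1 -> V) (c : 'I_d.+1 -> {scalar V}) (e : 'I_d.+1 -> R).
Implicit Types (x y : V) (i j : 'I_d.+1) (K : {set 'I_d.+1}).

Local Notation f i x := (c i x + e i).
Local Notation simplex := (hypersimplex 1 p c e).

Hypothesis d_gt0 : (0 < d)%N.
Hypothesis dual_pt : forall i j, f i (p j) = 1%:R * (i == j)%:R.

Definition simplex_face K : set V :=
  [set x | simplex x /\ forall i, i \notin K -> f i x = 0].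

Let support x := [set i | f i x != 0]%SET.

Let coord_vtx i j : f i (p j) = (i == j)%:R.
Proof. by rewrite dual_pt mul1r. Qed.

Lemma subset_center1 i : subset_center 1 p [set i] = p i.
Proof.
rewrite /subset_center /weighted_pt invr1 scale1r (bigD1 i)//= inE eqxx scale1r.
by rewrite big1 ?addr0// => j /negbTE ji; rewrite inE ji scale0r.
Qed.

Lemma cell_support x : simplex x ->
  cell (affine_span 1 p c e) c e x = simplex_face (support x).
Proof.
move=> Sx; apply/seteqP; split=> y [Sy xy]; split=> // i.
  by rewrite inE negbK => /eqP /(xy i).1.
split=> xi; first by apply: xy; rewrite inE negbK xi.
have xj j : j != i -> f j x = 0.
  move: Sx.1.2; rewrite (bigD1 i)//= xi => /eqP.
  rewrite eq_sym addrC -subr_eq subrr eq_sym.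
  rewrite psumr_eq0 => [/allP/(_ j)|l _]; last by have /andP[] := Sx.2 l.
  by rewrite mem_index_enum => /(_ isT)/implyP /[apply] /eqP.
have := Sy.1.2; rewrite (bigD1 i)//= big1 ?addr0// => j ji.
by apply: xy; rewrite inE negbK xj.
Qed.

Lemma support_neq0 x : simplex x -> support x != finset.set0.
Proof.
move=> Sx; apply/eqP => x0; have := Sx.1.2; rewrite big1 => [/eqP|i _].
  by rewrite eq_sym oner_eq0.
by have /setP/(_ i) := x0; rewrite !inE => /negbFE/eqP.
Qed.

Lemma simplex_faceE K : K != finset.set0 ->
  exists2 x, simplex x & simplex_face K = cell (affine_span 1 p c e) c e x.
Proof.
move=> K0; have Kgt : 0 < (#|K|%:R : R) by rewrite ltr0n card_gt0.
pose u i : R := (i \in K)%:R / #|K|%:R.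
have u1 : \sum_i u i = 1%:R.
  by rewrite -mulr_suml sum_indicator divff// gt_eqF.
have ux i : f i (weighted_pt 1 p u) = u i by exact: coord_pt.
have Sx : simplex (weighted_pt 1 p u).
  split; first exact: affine_span_pt.
  move=> i; rewrite ux /u; case: (i \in K); rewrite ?mul0r ?lexx ?ler01//.
  by rewrite mul1r invr_ge0 ltW//= invf_le1// ler1n card_gt0.
exists (weighted_pt 1 p u) => //; rewrite cell_support//; congr simplex_face.
apply/setP => i; rewrite inE ux /u; case: (i \in K); last by rewrite mul0r eqxx.
by rewrite mul1r invr_eq0 gt_eqF.
Qed.

Lemma simplex_face_vtx K j : j \in K -> simplex_face K (p j).
Proof.
move=> jK; split; last first.
  by move=> i; rewrite coord_vtx; case: eqP => // ->; rewrite jK.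
by rewrite -subset_center1; apply: hypersimplex_center => //; rewrite cards1.
Qed.

Lemma faces_simplex_face K : K != finset.set0 -> faces simplex (simplex_face K).
Proof. by move=> /simplex_faceE[x Sx ->]; apply: cell_face => // y []. Qed.

Lemma simplex_face1 j : simplex_face [set j] = [set p j].
Proof.
apply/seteqP; split=> x; last by move=> ->; apply: simplex_face_vtx; rewrite inE.
move=> [[[xE x1] _] xj] /=; rewrite xE /weighted_pt invr1 scale1r.
have x0 i : i != j -> f i x = 0 by move=> ij; apply: xj; rewrite inE.
move: x1; rewrite (bigD1 j)//= big1// addr0 => x1.
by rewrite (bigD1 j)//= x1 scale1r big1 ?addr0// => i /x0 ->; rewrite scale0r.
Qed.

Lemma vertices_simplex_face K : K != finset.set0 ->
  vertices (simplex_face K) = p @` [set` K].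
Proof.
move=> K0; have [x Sx KE] := simplex_faceE K0.
have ln := @affine_span_line _ _ _ 1 p c e isT dual_pt.
have hl := @hypersimplex_hull _ _ _ 1 p c e isT dual_pt.
apply/seteqP; split=> w.
  rewrite KE => vw.
  have [xw /subset_centersP[L /eqP/cards1P[j ->] wE]] := cell_vertex ln hl Sx vw.
  rewrite wE subset_center1; exists j => //=; apply: contraT => jK.
  move: xw; rewrite -KE wE subset_center1 => -[_ /(_ j jK)] /eqP.
  by rewrite coord_vtx eqxx oner_eq0.
move=> [j /= jK <-]; rewrite /vertices /= -simplex_face1.
have [|y Sy yE] := @simplex_faceE [set j]; first by apply/set0Pn; exists j; rewrite inE.
rewrite yE; apply: cell_face => // [|z []//].
by rewrite -yE simplex_face1 => z ->; exact: simplex_face_vtx.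
Qed.

Let p_inj : injective p.
Proof.
move=> i j pij; apply/eqP; have := coord_vtx i i.
by rewrite pij coord_vtx eqxx; case: eqP => // _ /eqP; rewrite eq_sym oner_eq0.
Qed.

Lemma fsbig_vtx (U : zmodType) (F : V -> U) K :
  \sum_(x \in p @` [set` K]) F x = \sum_(i in K) F (p i).
Proof.
rewrite fsbig_image; last by move=> i j _ _; exact: p_inj.
rewrite -big_enum [RHS]fsbig_seq ?enum_uniq//.
by apply: eq_fsbigl; apply/seteqP; split=> i /=; rewrite mem_enum.
Qed.

Lemma centroid_simplex_face K : K != finset.set0 ->
  centroid (simplex_face K) = subset_center #|K| p K.
Proof.
move=> K0; rewrite /centroid vertices_simplex_face// fsbig_vtx.
have fin : finite_set (p @` [set` K]) by apply: finite_image; exact: finite_finset.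
rewrite card_fset_sum1 natr_sum -fsbig_finite// fsbig_vtx -natr_sum sum1_card.
congr (_ *: _); rewrite big_mkcond; apply: eq_bigr => i _.
by case: (i \in K); rewrite ?scale1r ?scale0r.
Qed.

(** The differences [p i - p k], for [i] in [K] other than a fixed [k], span all
    differences of points of the face, and the barycentric coordinates show
    that they are independent. *)
Lemma affdim_simplex_face K : K != finset.set0 ->
  affdim (simplex_face K) = #|K|.-1.
Proof.
move=> /set0Pn[k kK].
have -> : #|K|.-1 = #|K :\ k| by rewrite (cardsD1 k) kK.
pose q (s : 'I_#|K :\ k|) := enum_val s.
have qK s : (q s != k) /\ (q s \in K).
  by apply/andP; have := enum_valP s; rewrite !inE.
pose M := \matrix_(s < #|K :\ k|) (p (q s) - p k).
apply/eqP; rewrite eqn_leq; apply/andP; split.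
  have [N /eqP Nrank NE] := affdimP (simplex_face K).
  rewrite -[leqLHS]Nrank; apply: leq_trans (rank_leq_row M).
  apply/mxrankS/row_subP => s.
  have [x [y [[[[xE x1] _] xK] [[[yE y1] _] yK] ->]]] := NE s.
  have -> : x - y = \sum_(i in K :\ k) (f i x - f i y) *: (p i - p k).
    rewrite {1}xE {1}yE /weighted_pt invr1 !scale1r -sumrB.
    under eq_bigr do rewrite -scalerBl.
    transitivity (\sum_i (f i x - f i y) *: (p i - p k)).
      under [RHS]eq_bigr do rewrite scalerBr.
      by rewrite sumrB -scaler_suml sumrB x1 y1 subrr scale0r subr0.
    rewrite [RHS]big_mkcond; apply: eq_bigr => i _; rewrite !inE.
    have [->|_] := eqVneq i k; first by rewrite subrr scaler0.
    by case: (boolP (i \in K)) => // iK; rewrite xK// yK// subrr scale0r.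
  apply: summx_sub => i iK; apply: scalemx_sub.
  have -> : p i - p k = row (enum_rank_in iK i) M by rewrite rowK /q enum_rankK_in.
  exact: row_sub.
apply: (@affdim_ge _ _ _ _ M); last first.
  move=> s; exists (p (q s)), (p k); rewrite rowK.
  by split=> //; apply: simplex_face_vtx => //; case: (qK s).
rewrite -kermx_eq0; apply/rowV0P => w /sub_kermxP wM.
apply/rowP => s; rewrite mxE.
have := congr1 (c (q s)) wM; rewrite mulmx_sum_row linear_sum linear0 (bigD1 s)//=.
have cB a b : c (q s) (p a - p b) = (q s == a)%:R - (q s == b)%:R.
  by rewrite linearB/= -!coord_vtx; ring.
rewrite linearZ/= rowK cB eqxx (negbTE (qK s).1) subr0 mulr1 big1 ?addr0// => l ls.
rewrite linearZ/= rowK cB (negbTE (qK s).1) (inj_eq enum_val_inj) eq_sym (negbTE ls).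
by rewrite subrr mulr0.
Qed.

(** The [r]-faces are spanned by [r + 1] of the vertices, whose center is the
    center of the face. *)
Lemma rectified_simplex_hull r :
  rectified_simplex r simplex = conv_hull [set` subset_centers r.+1 p].
Proof.
have ln := @affine_span_line _ _ _ 1 p c e isT dual_pt.
congr conv_hull; apply/seteqP; split=> x.
  move=> [F [SF Fr] <-].
  have hl := @hypersimplex_hull _ _ _ 1 p c e isT dual_pt.
  have [g Sg SE] := @hypersimplex_cell _ _ _ 1 p c e isT dual_pt d_gt0.
  move: SF; rewrite SE => /(face_cell ln hl Sg)[y gy FE].
  have Sy : simplex y by case: gy.
  have y0 := support_neq0 Sy.
  move: Fr; rewrite FE cell_support// affdim_simplex_face// => Fr.
  rewrite centroid_simplex_face//; apply/subset_centersP; exists (support y) => //.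
    by rewrite -Fr prednK// card_gt0.
  by rewrite -Fr prednK// card_gt0.
move=> /subset_centersP[K Kr ->].
have K0 : K != finset.set0 by rewrite -card_gt0 Kr.
exists (simplex_face K); last by rewrite centroid_simplex_face// Kr.
by split; [exact: faces_simplex_face|rewrite affdim_simplex_face// Kr].
Qed.

Lemma simplex_hull : simplex = conv_hull (range p).
Proof.
rewrite (hypersimplex_hull _ dual_pt)//; congr conv_hull; apply/seteqP; split=> x.
  by move=> /subset_centersP[L /eqP/cards1P[j ->] ->]; exists j; rewrite ?subset_center1.
move=> [j _ <-]; apply/subset_centersP; exists [set j]%SET; first by rewrite cards1.
by rewrite subset_center1.
Qed.

End Simplex.

(** In a regular simplex the inner product with [\sum_j (p i - p j)] takes the
    same value at all vertices but [p i]: by polarisation its values are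
    combinations of squared distances, all of which equal [l] or 0. *)
Lemma equidistant_dual (R : realType) (m d k : nat) (p : 'I_d.+1 -> 'rV[R]_m) l :
  0 < l -> (forall i j, i != j -> sqdist (p i) (p j) = l) ->
  exists (c : 'I_d.+1 -> {scalar 'rV[R]_m}) (e : 'I_d.+1 -> R),
    forall i j, c i (p j) + e i = k%:R * (i == j)%:R.
Proof.
move=> l0 pl.
have dist i j : sqdist (p i) (p j) = l * (1 - (i == j)%:R).
  have [->|ij] := eqVneq i j; last by rewrite pl// subr0 mulr1.
  by rewrite subrr mulr0 /sqdist big1// => s _; rewrite subrr expr0n.
pose h : R := k%:R / (d.+1%:R * l / 2).
pose g i (x : 'rV[R]_m) : R := \sum_s h * (\sum_j (p i 0 s - p j 0 s)) * x 0 s.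
have gl i : GRing.linear_for *%R (g i).
  move=> t x y; rewrite /g mulr_sumr -big_split; apply: eq_bigr => s _ /=.
  by rewrite !mxE; ring.
pose S i (G : {scalar 'rV[R]_m}) := forall x, G x = g i x.
have [c cE] := @boolp.choice _ _ S (fun i => scalar_form (gl i)).
exists c, (fun i => k%:R - g i (p i)) => i a.
rewrite cE.
have -> : g i (p a) + (k%:R - g i (p i)) = k%:R + (g i (p a) - g i (p i)) by ring.
(* Polarisation of the inner product of p i - p j with p a - p i. *)
have -> : g i (p a) - g i (p i) =
    h / 2 * \sum_j (sqdist (p i) (p i) - sqdist (p i) (p a) +
                    sqdist (p j) (p a) - sqdist (p j) (p i)).
  rewrite /g /sqdist -sumrB.
  under [in RHS]eq_bigr do rewrite -sumrB -big_split -sumrB.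
  rewrite exchange_big mulr_sumr; apply: eq_bigr => s _ /=.
  rewrite -mulrBr -[LHS]mulrA mulr_suml !mulr_sumr; apply: eq_bigr => j _ /=.
  by field.
under eq_bigr do rewrite !dist eqxx.
have one b : \sum_j (j == b :> 'I_d.+1)%:R = 1 :> R.
  by rewrite (bigD1 b)//= eqxx big1 ?addr0// => j /negbTE ->.
have -> : \sum_(j < d.+1) (l * (1 - 1%:R) - l * (1 - (i == a)%:R) +
      l * (1 - (j == a)%:R) - l * (1 - (j == i)%:R)) =
    d.+1%:R * l * ((i == a)%:R - 1).
  transitivity (\sum_(j < d.+1) (l * ((i == a)%:R - 1) +
      (l * (j == i)%:R - l * (j == a)%:R))).
    by apply: eq_bigr => j _; ring.
  rewrite big_split/= sumr_const card_ord sumrB -!mulr_sumr !one subrr addr0.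
  by rewrite -[LHS]mulr_natl mulrA.
rewrite /h; field.
by rewrite gt_eqF//= nat1r pnatr_eq0.
Qed.

(** * The two formulas *)

Lemma coef_XgeomM N b M : (('X * geom b) ^+ N)`_M =
  if (N <= M)%N then (geom b ^+ N)`_(M - N) else 0.
Proof. by rewrite exprMn coefXnM; case: ltnP. Qed.

Theorem theorem1 (R : realType) (m d r n : nat) (Delta : set 'rV[R]_m)
    (v : set 'rV[R]_m -> 'rV[R]_m) :
  (r < d)%N -> (1 <= n)%N -> regular_simplex d Delta -> vertex_choice v ->
  pnum v (rectified_simplex r Delta) n =
    \sum_(i < r.+1) (-1) ^+ (r - i) * 'C(d.+1, r - i)%:Z *
      seq_at (pnum v Delta) ((i%:Z + 1) * n%:Z - r%:Z)
  /\
  inum v (rectified_simplex r Delta) n =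
    \sum_(i < r.+1) (-1) ^+ (r - i) * 'C(d.+1, r - i)%:Z *
      seq_at (inum v Delta) ((i%:Z + 1) * n%:Z + r%:Z - 2 * i%:Z).
Proof.
move=> rd n1 [p [[l l0 pl] DE]] vP.
have d0 : (0 < d)%N by exact: leq_ltn_trans rd.
have [c1 [e1 dual1]] := equidistant_dual 1 l0 pl.
have [c [e dual]] := equidistant_dual r.+1 l0 pl.
have {}DE : Delta = hypersimplex 1 p c1 e1 by rewrite DE -(simplex_hull dual1).
have RE : rectified_simplex r Delta = hypersimplex r.+1 p c e.
  by rewrite DE (rectified_simplex_hull d0 dual1) -(hypersimplex_hull _ dual).
have pH1 t := hypersimplex_pnum (ltn0Sn _) dual1 d0 t vP.
have pHr t := hypersimplex_pnum (ltn0Sn _) dual rd t vP.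
have iH1 t := hypersimplex_inum (ltn0Sn _) dual1 d0 t vP.
have iHr t := hypersimplex_inum (ltn0Sn _) dual rd t vP.
have dimD := hypersimplex_dim_gt0 (ltn0Sn _) dual1 d0 vP.
have dimR := hypersimplex_dim_gt0 (ltn0Sn _) dual rd vP.
(* By stars and bars S t is the simplex number with index t + 1; extended by 0 to
   negative arguments it absorbs the truncations on both sides. *)
pose S := compositions d.+1.
have neg (y : int) : y < 0 -> seq_at S y = 0 by case: y.
have pD (z : int) : seq_at (pnum v Delta) z = seq_at S (z - 1).
  case: z => [[|t]|t]; first by rewrite /= pnum_0.
    by rewrite DE [LHS]pH1 mul1n (_ : t.+1%:Z - 1 = t%:Z)//; lia.
  by rewrite NegzE; have -> : - t.+1%:Z - 1 = Negz t.+1 by rewrite NegzE; lia.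
have iD (z : int) : seq_at (inum v Delta) z = seq_at S (z - 1 - d.+1%:Z).
  case: z => [[|[|t]]|t] //=.
  - by rewrite DE inum_small// neg.
  - by rewrite DE inum_small// neg.
  - rewrite DE [LHS]iH1 mul1n coef_XgeomM; case: ifP => dt; last by rewrite neg//; lia.
    have -> : t.+2%:Z - 1 - d.+1%:Z = (t.+1 - d.+1)%N%:Z by lia.
    by rewrite coef_geom_stable//; lia.
under eq_bigr do rewrite pD.
under [X in _ /\ _ = X]eq_bigr do rewrite iD.
have rN : (r <= d.+1)%N by lia.
rewrite RE; case: n n1 => [//|t _]; split.
  rewrite pHr coef_geom.
  rewrite (@sum_rev_trunc r _ (fun j => (-1) ^+ j * 'C(d.+1, j)%:Z *
      seq_at S ((r.+1 * t)%N%:Z - t.+1%:Z * j%:Z)))//; last first.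
    by move=> j rj; rewrite neg ?mulr0//; nia.
  apply: eq_bigr => i _; congr (_ * seq_at S _).
  by have := ltn_ord i; move: (nat_of_ord i) => a; nia.
case: t => [|t].
  rewrite inum_small// big1// => i _; rewrite neg ?mulr0//.
  by have := ltn_ord i; move: (nat_of_ord i) => a; lia.
rewrite iHr coef_XgeomM; case: ifP => dt; last first.
  rewrite big1// => i _; rewrite neg ?mulr0//.
  by have := ltn_ord i; move: (nat_of_ord i) => a; nia.
rewrite coef_geom.
rewrite (@sum_rev_trunc r _ (fun j => (-1) ^+ j * 'C(d.+1, j)%:Z *
    seq_at S ((r.+1 * t.+1 - d.+1)%N%:Z - t%:Z * j%:Z)))//; last first.
  by move=> j rj; rewrite neg ?mulr0//; nia.
apply: eq_bigr => i _; congr (_ * seq_at S _).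
by have := ltn_ord i; move: (nat_of_ord i) => a; nia.
Qed.
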